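(* Let $q$ be a prime power and let $n\ge 3$ be an integer. Then \[ s_q(n,3)=(n-2)q^4(q-1)+(n-1)(n-2)q^2(q-1)^2+\binom{n}{3}(q-1)^3. \]
   Context: $\mathbb{F}_q$ is the finite field with $q$ elements. $\mathrm{U}(n,\mathbb{F}_q)$ is the $\mathbb{F}_q$-vector space of $n\times n$ upper triangular matrices over $\mathbb{F}_q$ (entries $m_{i,j}=0$ whenever $i>j$). For $M\in \mathrm{U}(n,\mathbb{F}_q)$ and $1\le i\le n$, $M_{[i]}$ is the $i\times(n-i+1)$ submatrix of $M$ obtained by deleting the first $i-1$ columns and the last $n-i$ rows (i.e. rows $1,\dots,i$ and columns $i,\dots,n$). The flag-rank weight of $M$ is $\mathrm{fr}(M)=\sum_{i=1}^{n}\mathrm{rk}(M_{[i]})$. The number $s_q(n,t)$ is the size of the flag-rank sphere of radius $t$: $s_q(n,t)=|\{A\in \mathrm{U}(n,\mathbb{F}_q):\mathrm{fr}(A)=t\}|$. *)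

(* Defs.v *)
From mathcomp Require Import all_boot all_order all_algebra.

Set Implicit Arguments.
Unset Strict Implicit.
Unset Printing Implicit Defensive.

Import GRing.Theory.
Local Open Scope ring_scope.

(* MathComp's is_trig_mx means lower triangular, hence this definition. *)
Definition upper_trig (F : finFieldType) (n : nat) : {set 'M[F]_n} :=
  [set M : 'M[F]_n | [forall i : 'I_n, forall j : 'I_n, (j < i)%N ==> (M i j == 0)]].

(* Indices are 0-based: for i : 'I_n this is the matrix M_[i+1], made of rows
   0, ..., i and columns i, ..., n-1 of M. *)
Definition corner_mx (F : finFieldType) (n : nat) (M : 'M[F]_n) (i : 'I_n) :
    'M[F]_(i.+1, n - i) :=
  mxsub (widen_ord (ltn_ord i))
        (fun j : 'I_(n - i) => cast_ord (subnKC (ltnW (ltn_ord i))) (rshift i j))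
        M.

Definition flag_rank (F : finFieldType) (n : nat) (M : 'M[F]_n) : nat :=
  (\sum_(i < n) \rank (corner_mx M i))%N.

Definition flag_rank_sphere (F : finFieldType) (n t : nat) : {set 'M[F]_n} :=
  [set A in upper_trig F n | flag_rank A == t].

(* Main.v *)
Require Import Defs.
From mathcomp Require Import all_boot all_order all_algebra.
From mathcomp Require Import zify ring.

(** A nonzero 2x2 minor in a corner forces flag rank at least 4, so a matrix of
flag rank 3 has all its corners of rank at most 1 and exactly three of them
nonzero. On such a matrix M three situations are possible. If some M(a, a+2) is
nonzero, then M is supported on rows and columns a, ..., a+2 and is the upper
triangular part of p s^T with p(a) = 1 and s(a+2) nonzero; p and s have 4 free
entries, which gives (n-2) q^4 (q-1). Otherwise, if some M(a, a+1) is nonzero,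
M is such a block of length 2 plus one nonzero diagonal entry outside it, which
gives (n-1)(n-2) q^2 (q-1)^2. Otherwise M is diagonal with three nonzero
entries. *)

Set Implicit Arguments.
Unset Strict Implicit.
Unset Printing Implicit Defensive.

Import GRing.Theory.

(** * Rank at most 1 in terms of 2x2 minors *)

Section RankOne.

Local Open Scope ring_scope.

(** A base factorisation through dimension 0 or 1 makes all minors vanish. Conversely, a nonzero
    pivot [A i0 j0] and vanishing minors make [A] the product of its column [j0] and its rescaled
    row [i0]. *)
Lemma mxrank_le1P (F : fieldType) (m n : nat) (A : 'M[F]_(m, n)) :
  reflect (forall i i' j j', A i j * A i' j' = A i j' * A i' j)
          (\rank A <= 1)%N.
Proof.
apply: (iffP idP) => [|minors].
  have := mulmx_base A; move: (col_base A) (row_base A).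
  case: (\rank A) => [|[|//]] C R <- _ i i' j j'; rewrite !mxE.
    by rewrite !big_ord0 !mul0r.
  by rewrite !big_ord1; ring.
have [->|/matrix0Pn [i0 [j0 nz]]] := eqVneq A 0; first by rewrite mxrank0.
have -> : A = col j0 A *m ((A i0 j0)^-1 *: row i0 A).
  apply/matrixP => i j; rewrite !mxE big_ord1 !mxE.
  by rewrite mulrCA (minors i i0 j0 j) mulrC mulfK.
by rewrite (leq_trans (mxrankM_maxl _ _)) // rank_leq_col.
Qed.

End RankOne.

(** * Corners and flag rank *)

Section Corners.

Local Open Scope ring_scope.
Variables (F : finFieldType) (n : nat).
Implicit Types (M : 'M[F]_n) (i j k : 'I_n).

Definition upper M := forall i j, (j < i)%N -> M i j = 0.

(** Rank at most 1 for every corner, stated on the entries of [M] to avoid the index types of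
    [corner_mx], which depend on [k]. *)
Definition corner_minors0 M := forall i i' k j j',
  (i <= k)%N -> (i' <= k)%N -> (k <= j)%N -> (k <= j')%N ->
  M i j * M i' j' = M i j' * M i' j.

Definition live M : {set 'I_n} := [set k | corner_mx M k != 0].

Lemma upper_trigP M : reflect (upper M) (M \in upper_trig F n).
Proof.
rewrite inE; apply: (iffP forallP) => [up i j ji | up i].
  by apply/eqP; move/forallP/(_ j)/implyP: (up i); apply.
by apply/forallP => j; apply/implyP => ji; rewrite up.
Qed.

Lemma corner_mxE M k i j (ik : (i < k.+1)%N) (jk : (j - k < n - k)%N) :
  (k <= j)%N -> corner_mx M k (Ordinal ik) (Ordinal jk) = M i j.
Proof.
by move=> kj; rewrite mxE; congr (M _ _); apply/val_inj => //=; rewrite subnKC.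
Qed.

Lemma corner_mxP M k (x : 'I_k.+1) (y : 'I_(n - k)) :
  exists i j, [/\ (i <= k)%N, (k <= j)%N & corner_mx M k x y = M i j].
Proof.
rewrite mxE; set i := widen_ord _ _; set j := cast_ord _ _.
by exists i, j; split=> //=; [rewrite -ltnS | rewrite leq_addr].
Qed.

Lemma liveP M k :
  reflect (exists i j, [/\ (i <= k)%N, (k <= j)%N & M i j != 0])
          (k \in live M).
Proof.
rewrite inE; apply: (iffP (matrix0Pn _)) => [[x [y nz]] | [i [j [ik kj nz]]]].
  have [i [j [ik kj e]]] := corner_mxP M x y.
  by exists i, j; rewrite -e.
have jk : (j - k < n - k)%N by rewrite ltn_sub2r.
have ik' : (i < k.+1)%N by rewrite ltnS.
by exists (Ordinal ik'), (Ordinal jk); rewrite corner_mxE.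
Qed.

Lemma corner_rank_le1P M k :
  (\rank (corner_mx M k) <= 1)%N <->
  forall i i' j j', (i <= k)%N -> (i' <= k)%N -> (k <= j)%N -> (k <= j')%N ->
  M i j * M i' j' = M i j' * M i' j.
Proof.
split=> [/mxrank_le1P rk i i' j j' ik i'k kj kj' | minors].
  have jk (l : 'I_n) : (k <= l)%N -> (l - k < n - k)%N.
    by move=> kl; rewrite ltn_sub2r.
  rewrite -ltnS in ik; rewrite -ltnS in i'k.
  have := rk (Ordinal ik) (Ordinal i'k)
    (Ordinal (jk j kj)) (Ordinal (jk j' kj')).
  by rewrite !corner_mxE.
apply/mxrank_le1P => x x' y y'; rewrite !mxE.
by apply: minors; rewrite /= ?leq_addr // -ltnS.
Qed.

(** Each corner has rank 0 or 1 here, so its rank is the indicator of [live M]. *)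
Lemma flag_rank_eq_card_live M :
  corner_minors0 M -> flag_rank M = #|live M|.
Proof.
move=> minors; rewrite /flag_rank -sum1_card [RHS]big_mkcond /=.
apply: eq_bigr => k _; rewrite inE -mxrank_eq0.
have /corner_rank_le1P : forall i i' j j', (i <= k)%N -> (i' <= k)%N ->
    (k <= j)%N -> (k <= j')%N -> M i j * M i' j' = M i j' * M i' j.
  by move=> i i' j j'; apply: minors.
by case: (\rank _) => [|[]].
Qed.

(* A nonzero minor in corner k puts a nonzero entry in some corner before k and
   in some corner after k, so the flag rank is at least 1 + 2 + 1. *)
Lemma flag_rank_le3_minors M : (flag_rank M <= 3)%N -> corner_minors0 M.
Proof.
move=> fr3 i i' k j j' ik i'k kj kj'; apply/eqP/negPn/negP => ne.
have ii' : (i : nat) <> i'.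
  by move/val_inj=> e; move: ne; rewrite e mulrC eqxx.
have jj' : (j : nat) <> j' by move/val_inj=> e; move: ne; rewrite e eqxx.
(* Two entries in the same row or column of the minor cannot both vanish, since both of its products
   would vanish with them. *)
have nz_of r c r' c' : (M r c = 0 -> M r' c' = 0 ->
    M i j * M i' j' == M i j' * M i' j) -> (M r c != 0) || (M r' c' != 0).
  move=> H; apply: contraNT ne; rewrite negb_or !negbK.
  by case/andP => /eqP ? /eqP; apply: H.
have simp0 := (mul0r, mulr0, eqxx).
(* [i] and [i'] are distinct and at most [k], so one is below [k]. That row of the minor has a
   nonzero entry, which also lies in the corner of that smaller index. *)
have [l lk lv] : exists2 l : 'I_n, (l < k)%N & l \in live M.
  have [lt|ge] := ltnP i k.
    exists i => //; apply/liveP.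
    have /orP [nz|nz] : (M i j != 0) || (M i j' != 0).
    - by apply: nz_of => -> ->; rewrite !simp0.
    - by exists i, j; split=> //; apply: leq_trans kj.
    - by exists i, j'; split=> //; apply: leq_trans kj'.
  have lt : (i' < k)%N by lia.
  exists i' => //; apply/liveP.
  have /orP [nz|nz] : (M i' j != 0) || (M i' j' != 0).
  - by apply: nz_of => -> ->; rewrite !simp0.
  - by exists i', j; split=> //; apply: leq_trans kj.
  - by exists i', j'; split=> //; apply: leq_trans kj'.
(* The same argument on the columns [j] and [j']. *)
have [h kh hv] : exists2 h : 'I_n, (k < h)%N & h \in live M.
  have [lt|ge] := ltnP k j.
    exists j => //; apply/liveP.
    have /orP [nz|nz] : (M i j != 0) || (M i' j != 0).
    - by apply: nz_of => -> ->; rewrite !simp0.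
    - by exists i, j; split=> //; apply: leq_trans kj.
    - by exists i', j; split=> //; apply: leq_trans kj.
  have lt : (k < j')%N by lia.
  exists j' => //; apply/liveP.
  have /orP [nz|nz] : (M i j' != 0) || (M i' j' != 0).
  - by apply: nz_of => -> ->; rewrite !simp0.
  - by exists i, j'; split=> //; apply: leq_trans kj'.
  - by exists i', j'; split=> //; apply: leq_trans kj'.
have rk2 : (1 < \rank (corner_mx M k))%N.
  rewrite ltnNge; apply: contra ne => /corner_rank_le1P rk1.
  by apply/eqP; apply: rk1.
move: lv hv; rewrite !inE -!mxrank_eq0 -!lt0n => rl rh; move: fr3.
rewrite /flag_rank (bigD1 k) //= (bigD1 l) /=; last by rewrite neq_ltn lk.
rewrite (bigD1 h) /=; last first.
  by rewrite !neq_ltn kh (ltn_trans lk kh) !orbT.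
move: rk2 rl rh.
move: (\rank _) (\rank _) (\rank _) (\sum_(_ < _ | _) _)%N => a b c d.
lia.
Qed.

(** Ranks disappear here: on the sphere it remains to count nonzero corners. *)
Lemma flag_rank_sphere3P M :
  M \in flag_rank_sphere F n 3 <->
  [/\ upper M, corner_minors0 M & #|live M| = 3].
Proof.
rewrite in_set; split=> [/andP [/upper_trigP up /eqP fr] | [up minors lv]].
  have minors : corner_minors0 M by apply: flag_rank_le3_minors; rewrite fr.
  by split=> //; rewrite -flag_rank_eq_card_live.
by apply/andP; split; [apply/upper_trigP | rewrite flag_rank_eq_card_live ?lv].
Qed.

End Corners.

(** * Truncated outer products *)

Section Blocks.

Local Open Scope ring_scope.
Variables (F : finFieldType) (n : nat).
Implicit Types (M : 'M[F]_n) (i j k : 'I_n).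

(** The default 0 of [nth] covers indices past the end of [s]; the test covers those before [a],
    where [i - a] would truncate to 0. *)
Definition pad a (s : seq F) i := if (a <= i)%N then s`_(i - a) else 0.

(** In [(s, p, z)], the row factor is [s] followed by [z] and the column factor is 1 followed by
    [p]. Thus [z] is the entry at the far end of the first row of the block. *)
Definition block_data d := (d.-tuple F * d.-tuple F * F)%type.

Definition block_data_set d : {set block_data d} := setX setT [set~ 0].

(* Every corner of the truncated outer product is an honest outer product, and
   normalising the first column entry to 1 makes the factorisation unique. *)
Definition block d a (u : block_data d) : 'M[F]_n :=
  \matrix_(i, j) if (i <= j)%N
                 then pad a (1 :: u.1.2) i * pad a (rcons u.1.1 u.2) j else 0.

Definition span_set a d : {set 'I_n} := [set k : 'I_n | (a <= k <= a + d)%N].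

Lemma card_block_data_set d :
  #|block_data_set d| = (#|F| ^ d * #|F| ^ d * (#|F| - 1))%N.
Proof.
rewrite cardsX cardsT card_prod !card_tuple; congr (_ * _)%N.
by rewrite subn1 cardsC1.
Qed.

Lemma card_span_set a d : (a + d < n)%N -> #|span_set a d| = d.+1.
Proof.
move=> lt; have lt' (t : 'I_d.+1) : (a + t < n)%N.
  by rewrite (leq_ltn_trans _ lt) // leq_add2l -ltnS.
rewrite -[RHS]card_ord -cardsT.
have -> : span_set a d = [set Ordinal (lt' t) | t in setT].
  apply/setP => k; rewrite inE; apply/andP/imsetP => [[ak kd] | [t _ ->]] /=.
    have kt : (k - a < d.+1)%N by rewrite ltnS leq_subLR.
    by exists (Ordinal kt) => //; apply/val_inj; rewrite /= subnKC.
  by rewrite leq_addr leq_add2l -ltnS.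
by apply: card_imset => t t' /(congr1 val) /= /addnI /val_inj.
Qed.

Lemma block_neq0 d a (u : block_data d) i j :
  block a u i j != 0 -> [&& a <= i, i <= j & j <= a + d]%N.
Proof.
rewrite mxE; case: leqP => [ij|]; last by rewrite eqxx.
rewrite mulf_eq0 negb_or /pad => /andP [].
case: leqP => //= [ai _|]; last by rewrite eqxx.
rewrite (leq_trans ai ij); have [//|dj] := leqP j (a + d)%N.
by rewrite nth_default ?eqxx // size_rcons size_tuple; lia.
Qed.

Lemma block_upper d a (u : block_data d) : upper (block a u).
Proof. by move=> i j ji; rewrite mxE leqNgt ji. Qed.

Lemma block_minors0 d a (u : block_data d) : corner_minors0 (block a u).
Proof.
move=> i i' k j j' ik i'k kj kj'; rewrite !mxE.
by rewrite (leq_trans ik kj) (leq_trans i'k kj) (leq_trans ik kj')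
  (leq_trans i'k kj'); ring.
Qed.

Lemma block_row d a (u : block_data d) i j : i = a :> nat ->
  block a u i j = pad a (rcons u.1.1 u.2) j.
Proof.
move=> ia; rewrite mxE /pad ia leqnn subnn mul1r.
by case: leqP.
Qed.

Lemma block_col d a (u : block_data d) i j :
  (i <= j)%N -> j = (a + d)%N :> nat ->
  block a u i j = pad a (1 :: u.1.2) i * u.2.
Proof.
move=> ij jd; rewrite mxE ij; congr (_ * _).
by rewrite /pad jd leq_addr addKn nth_rcons size_tuple ltnn eqxx.
Qed.

Lemma block_end d a (u : block_data d) i j :
  i = a :> nat -> j = (a + d)%N :> nat -> block a u i j = u.2.
Proof.
move=> ia jd; rewrite block_row // /pad jd leq_addr addKn.
by rewrite nth_rcons size_tuple ltnn eqxx.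
Qed.

(** The first row gives the row factor, and the last column gives the column factor after cancelling
    the nonzero end entry. Agreement is asked on the span only, so that an extra entry elsewhere
    does no harm. *)
Lemma block_inj d a (u u' : block_data d) : (a + d < n)%N -> u.2 != 0 ->
  {in span_set a d &, block a u =2 block a u'} -> u = u'.
Proof.
move=> lt nz eqM.
have lt' t : (t <= d)%N -> (a + t < n)%N.
  by move=> td; rewrite (leq_ltn_trans _ lt) // leq_add2l.
have in_span t (td : (t <= d)%N) : Ordinal (lt' t td) \in span_set a d.
  by rewrite inE /= leq_addr leq_add2l.
have eq2 : u.2 = u'.2.
  have := eqM _ _ (in_span 0%N isT) (in_span d (leqnn d)).
  by rewrite !block_end //= addn0.
have rows t : (t <= d)%N ->
    (rcons u.1.1 u.2)`_t = (rcons u'.1.1 u'.2)`_t.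
  move=> td; have := eqM _ _ (in_span 0%N isT) (in_span t td).
  by rewrite !block_row /= ?addn0 // /pad leq_addr addKn.
have cols t : (t <= d)%N -> (1 :: u.1.2)`_t = (1 :: u'.1.2)`_t.
  move=> td; have := eqM _ _ (in_span t td) (in_span d (leqnn d)).
  rewrite !block_col /= ?leq_add2l // /pad leq_addr addKn -eq2.
  exact: mulIf.
case: u u' eq2 rows cols {nz eqM} => [[s p] z] [[s' p'] z'] /= -> rows cols.
congr (_, _, _); apply: eq_from_tnth => t; rewrite !(tnth_nth 0).
  by have := rows t (ltnW (ltn_ord t)); rewrite !nth_rcons !size_tuple ltn_ord.
exact: cols t.+1 (ltn_ord t).
Qed.

(** The factors are row [x] and column [y] divided by the pivot [M x y]. The minor identity is asked
    for [i <= j] only: then its four positions all lie in corner [i]. *)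
Lemma block_exists d a M (x y : 'I_n) :
  x = a :> nat -> y = (a + d)%N :> nat -> M x y != 0 ->
  (forall i j, M i j != 0 -> [&& a <= i, i <= j & j <= a + d]%N) ->
  (forall i j, (x <= i)%N -> (i <= j)%N -> (j <= y)%N ->
     M i j * M x y = M i y * M x j) ->
  exists2 u : block_data d, u.2 = M x y & M = block a u.
Proof.
move=> xa yd nz supp minors; set z := M x y.
(* The default [x] of [insubd] is never reached, since these indices are at most [y]. *)
pose s := [tuple M x (insubd x (a + t)%N) | t < d].
pose p := [tuple M (insubd x (a + t.+1)%N) y / z | t < d].
have M0 i j : ~~ [&& a <= i, i <= j & j <= a + d]%N -> M i j = 0.
  by move=> out; apply: contraNeq out => /supp.
have row j : M x j = pad a (rcons s z) j.
  rewrite /pad; case: leqP => aj; last by apply: M0; lia.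
  rewrite nth_rcons size_tuple; case: ltngtP => jd.
  - rewrite (nth_mktuple _ _ (Ordinal jd)) /= subnKC //; congr (M _ _).
    by apply/val_inj; rewrite val_insubd ltn_ord.
  - by apply: M0; lia.
  - by congr (M _ _); apply/val_inj => /=; lia.
have col i : M i y = pad a (1 :: p) i * z.
  rewrite /pad; case: leqP => ai; last by rewrite mul0r; apply: M0; lia.
  have [lt|gt|eq] := ltngtP a i; last 1 first.
  - rewrite -eq subnn mul1r; congr (M _ _).
    by apply/val_inj; rewrite /= xa eq.
  - have -> : (i - a = (i - a).-1.+1)%N by lia.
    have [id|di] := leqP i y.
      have td : ((i - a).-1 < d)%N by lia.
      rewrite /= (nth_mktuple _ _ (Ordinal td)) /= divfK //; congr (M _ _).
      have e : (a + (i - a).-1.+1 = i)%N by lia.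
      by apply/val_inj; rewrite val_insubd e ltn_ord.
    rewrite /= nth_default ?mul0r ?size_tuple ?card_ord; last by lia.
    by apply: M0; lia.
  - by lia.
exists (s, p, z) => //; apply/matrixP => i j; rewrite !mxE.
case: leqP => [ij|ji]; last by apply: M0; lia.
rewrite -row; apply: (mulIf nz); rewrite -/z mulrAC -col.
(* Outside the block both sides vanish by the support condition. *)
have [ai|ai] := leqP x i; last first.
  by rewrite !(M0 i) ?mul0r //; lia.
have [jy|jy] := leqP j y; first exact: minors.
by rewrite (M0 i j) ?(M0 x j) ?mul0r ?mulr0 //; lia.
Qed.

(** The end entry, at [(a, a + d)], lies in every corner from [a] to [a + d]; no other corner meets
    the support. *)
Lemma live_block d a (u : block_data d) : (a + d < n)%N -> u.2 != 0 ->
  live (block a u) = span_set a d.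
Proof.
move=> lt nz; have lta : (a < n)%N by apply: leq_ltn_trans lt; apply: leq_addr.
apply/setP => k; rewrite [in RHS]inE; apply/liveP/andP.
  case=> i [j [ik kj /block_neq0]]; lia.
case=> ak kd; exists (Ordinal lta), (Ordinal lt); split=> //.
by rewrite block_end.
Qed.

End Blocks.

(** * The three families and their cardinals *)

Section Families.

Local Open Scope ring_scope.
Variables (F : finFieldType) (n : nat).
Implicit Types (M : 'M[F]_n) (i j k : 'I_n).

Lemma card_shift d : #|[set a : 'I_n | (a + d < n)%N]| = (n - d)%N.
Proof.
rewrite -[RHS]card_ord -cardsT.
have lt (t : 'I_(n - d)) : (t < n)%N by move: (ltn_ord t); lia.
have -> : [set a : 'I_n | (a + d < n)%N] = [set Ordinal (lt t) | t in setT].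
  apply/setP => a; rewrite inE; apply/idP/imsetP => [ad | [t _ ->]] /=.
    have at_ : (a < n - d)%N by lia.
    by exists (Ordinal at_) => //; apply/val_inj.
  by move: (ltn_ord t); lia.
by apply: card_imset => t t' /(congr1 val) /= /val_inj.
Qed.

(** Functions are sorted by their support: each set of [m] points carries [(#|F| - 1) ^ m] functions
    that are nonzero exactly there. *)
Lemma card_support_eq (T : finType) m :
  #|[set f : {ffun T -> F} | #|[set t | f t != 0]| == m]| =
  ('C(#|T|, m) * (#|F| - 1) ^ m)%N.
Proof.
rewrite -sum1_card.
rewrite (partition_big (fun f : {ffun T -> F} => [set t | f t != 0])
  (fun A : {set T} => #|A| == m)) /=; last by move=> f; rewrite inE.
rewrite -card_draws -sum1dep_card big_distrl /=.
apply: eq_bigr => A /eqP cA; rewrite mul1n.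
transitivity #|pffun_on (0 : F) (mem A) (predC1 0)|; last first.
  by rewrite card_pffun_on cardC1 cA subn1.
rewrite -sum1_card; apply: eq_bigl => f; rewrite inE.
apply/andP/pffun_onP => [[_ /eqP <-] | [/subsetP sub im]].
  split; first by apply/subsetP => t; rewrite !inE.
  by move=> _ /imageP [t ft ->]; move: ft; rewrite !inE.
suff -> : [set t | f t != 0] = A by rewrite cA.
apply/setP => t; rewrite inE; apply/idP/idP => [|tA]; first exact: sub.
by have := im (f t); rewrite !inE; apply; apply: image_f.
Qed.

Definition fn_diag_mx (f : {ffun 'I_n -> F}) : 'M[F]_n :=
  \matrix_(i, j) if i == j then f i else 0.

Definition block_point_mx d (x : 'I_n * 'I_n * (block_data F d * F)) :
    'M[F]_n :=
  block n x.1.1 x.2.1 + x.2.2 *: delta_mx x.1.2 x.1.2.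

Definition diag_family m : {set 'M[F]_n} :=
  fn_diag_mx @: [set f : {ffun 'I_n -> F} | #|[set t | f t != 0]| == m].

Definition block_family d : {set 'M[F]_n} :=
  [set block n x.1 x.2 | x : 'I_n * block_data F d in
     setX [set a : 'I_n | (a + d < n)%N] (block_data_set F d)].

Definition away_pairs d : {set 'I_n * 'I_n} :=
  [set x : 'I_n * 'I_n | (x.1 + d < n)%N & x.2 \notin span_set n x.1 d].

Definition block_point_family d : {set 'M[F]_n} :=
  @block_point_mx d @:
    setX (away_pairs d) (setX (block_data_set F d) [set~ 0]).

Lemma block_familyP d M :
  reflect (exists (a : 'I_n) (u : block_data F d),
             [/\ (a + d < n)%N, u.2 != 0 & M = block n a u])
          (M \in block_family d).
Proof.
apply: (iffP imsetP) => [[[a u]]|[a [u [ad nz ->]]]].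
  by rewrite !inE /= => /andP [ad nz] ->; exists a, u.
by exists (a, u); rewrite // !inE /= ad.
Qed.

Lemma block_point_familyP d M :
  reflect (exists (a c : 'I_n) (u : block_data F d) (v : F),
             [/\ (a + d < n)%N, ~~ (a <= c <= a + d)%N, u.2 != 0, v != 0
               & M = block_point_mx (a, c, (u, v))])
          (M \in block_point_family d).
Proof.
apply: (iffP imsetP) => [[[[a c] [u v]]]|[a [c [u [v [ad out nz vn ->]]]]]].
  rewrite !inE /= => /andP [/andP [ad out] /andP [nz vn]] ->.
  by exists a, c, u, v.
by exists (a, c, (u, v)); rewrite // !inE /= ad out nz.
Qed.

(** Each of the [n - d] possible starts leaves [n - d.+1] indices outside its span. *)
Lemma card_away_pairs d : #|away_pairs d| = ((n - d) * (n - d.+1))%N.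
Proof.
rewrite -sum1_card (eq_bigl (fun x : 'I_n * 'I_n =>
  (x.1 + d < n)%N && (x.2 \notin span_set n x.1 d)));
  last by move=> x; rewrite inE.
rewrite -(pair_big_dep (fun a : 'I_n => (a + d < n)%N)
  (fun a c : 'I_n => c \notin span_set n a d) (fun _ _ => 1%N)) /=.
rewrite -(card_shift d) -sum1dep_card big_distrl /=.
apply: eq_bigr => a ad; rewrite mul1n sum1dep_card.
have := cardsC (span_set n a d); rewrite card_span_set // card_ord => e.
have -> : [set c | c \notin span_set n a d] = ~: span_set n a d.
  by apply/setP => c; rewrite !inE.
by rewrite -[X in (X - _)%N]e addKn.
Qed.

Lemma card_diag_family m :
  #|diag_family m| = ('C(n, m) * (#|F| - 1) ^ m)%N.
Proof.
rewrite card_imset ?card_support_eq ?card_ord // => f g /matrixP eqM.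
by apply/ffunP => i; have := eqM i i; rewrite !mxE eqxx.
Qed.

Lemma card_block_family d :
  #|block_family d| = ((n - d) * (#|F| ^ d * #|F| ^ d * (#|F| - 1)))%N.
Proof.
rewrite card_in_imset; first by rewrite cardsX card_shift card_block_data_set.
case=> [a u] [a' u']; rewrite !inE /= => /andP [ad nz] /andP [ad' nz'] eqM.
(* The nonzero end entry of one block lies in the support of the other, whose start is therefore no
   later; by symmetry the starts agree. *)
have le (b b' : 'I_n) (v v' : block_data F d) : (b + d < n)%N -> v.2 != 0 ->
    block n b v = block n b' v' -> (b' <= b)%N.
  move=> bd vnz e.
  suff /block_neq0/and3P [//] : block n b' v' b (Ordinal bd) != 0.
  by rewrite -e block_end.
have {le} aa' : a = a'.
  apply/val_inj/anti_leq; rewrite (le _ _ _ _ ad nz eqM).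
  by rewrite (le _ _ _ _ ad' nz' (esym eqM)).
rewrite -aa' in eqM *; rewrite (block_inj ad nz (u' := u')) // => i j _ _.
by rewrite eqM.
Qed.

Lemma block_point_mxE d x i j : @block_point_mx d x i j =
  block n x.1.1 x.2.1 i j + (if (i == x.1.2) && (j == x.1.2) then x.2.2 else 0).
Proof.
by rewrite mxE; congr (_ + _); rewrite !mxE; case: ifP; rewrite ?mulr1 ?mulr0.
Qed.

Lemma block_point_mx_neq0 d x i j : @block_point_mx d x i j != 0 ->
  [&& x.1.1 <= i, i <= j & j <= x.1.1 + d]%N || (i == x.1.2) && (j == x.1.2).
Proof.
rewrite block_point_mxE; case: ifP => _; first by rewrite orbT.
by rewrite addr0 => /block_neq0 ->.
Qed.

(* The isolated diagonal entry lies outside the block, so a block of length at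
   least 2 can be read off from its nonzero end, which is off the diagonal. *)
Lemma card_block_point_family d : (0 < d)%N ->
  #|block_point_family d| =
  ((n - d) * (n - d.+1) * (#|F| ^ d * #|F| ^ d * (#|F| - 1) * (#|F| - 1)))%N.
Proof.
move=> d0; rewrite card_in_imset.
  by rewrite cardsX card_away_pairs cardsX card_block_data_set cardsC1 subn1.
have le (x x' : 'I_n * 'I_n * (block_data F d * F)) :
    (x.1.1 + d < n)%N -> x.1.2 \notin span_set n x.1.1 d ->
    x.2.1.2 != 0 -> @block_point_mx d x = block_point_mx x' ->
    (x'.1.1 <= x.1.1)%N.
  move=> xd out nz e.
  have : block_point_mx x' x.1.1 (Ordinal xd) != 0.
    rewrite -e block_point_mxE block_end //= ifF ?addr0 //.
    apply/negbTE; apply: contra out => /andP [/eqP <- _].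
    by rewrite inE leqnn leq_addr.
  case/block_point_mx_neq0/orP => [/and3P [] //|].
  case/andP => /eqP <- /eqP /(congr1 val).
  by move=> /=; lia.
case=> [[a c] [u v]] [[a' c'] [u' v']].
rewrite !inE /= => /andP [/andP [ad out] /andP [nz vn]].
move=> /andP [/andP [ad' out'] /andP [nz' vn']] eqM.
have aa' : a = a'.
  apply/val_inj/anti_leq.
  rewrite (le _ _ _ _ _ eqM) ?inE //=.
  by rewrite (le _ _ _ _ _ (esym eqM)) ?inE.
rewrite -{}aa' in eqM out' ad' *.
have eqE i j : block n a u i j + (if (i == c) && (j == c) then v else 0) =
    block n a u' i j + (if (i == c') && (j == c') then v' else 0).
  by have := congr1 (fun A : 'M_n => A i j) eqM; rewrite !block_point_mxE.
have block_c (w : block_data F d) (b : 'I_n) :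
    ~~ (a <= b <= a + d)%N -> block n a w b b = 0.
  by move=> bout; apply: contraNeq bout => /block_neq0 /and3P [-> _ ->].
(* Neither block reaches [(c, c)], so this entry gives [v = v'] if [c = c'], and [v = 0]
   otherwise. *)
have := eqE c c; rewrite !eqxx !block_c // !add0r /=.
case: eqP => /= [cc' vv' | _ v0]; last by rewrite v0 eqxx in vn.
rewrite -cc' -vv' in eqE *.
rewrite (block_inj ad nz (u' := u')) // => i j ia ja.
have ic : (i == c) = false.
  by apply/negbTE; apply: contra out => /eqP <-; move: ia; rewrite inE.
by have := eqE i j; rewrite ic !addr0.
Qed.

End Families.

(** * Decomposition of the sphere of radius 3 *)

Section RadiusThree.

Local Open Scope ring_scope.
Variables (F : finFieldType) (n : nat).
Implicit Types (M : 'M[F]_n) (i j k : 'I_n).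

Lemma point_minors0 k (v : F) i i' j j' :
  let e i j := if (i == k) && (j == k) then v else 0 in
  e i j * e i' j' = e i j' * e i' j.
Proof.
by rewrite /=; case: (i == k); case: (i' == k); case: (j == k); case: (j' == k);
  rewrite /= ?mul0r ?mulr0.
Qed.

(** The only diagonal position in corner [k] is [(k, k)], so that corner is live exactly when this
    entry is nonzero. *)
Lemma diag_family_sub : diag_family F n 3 \subset flag_rank_sphere F n 3.
Proof.
apply/subsetP => _ /imsetP [f + ->]; rewrite inE => /eqP f3.
apply/flag_rank_sphere3P; split.
- by move=> i j ji; rewrite mxE -val_eqE /= gtn_eqF.
- move=> i i' k j j' ik i'k kj kj'.
  have e (l m : 'I_n) : (l <= k)%N -> (k <= m)%N ->
      fn_diag_mx f l m = if (l == k) && (m == k) then f k else 0.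
    move=> lk km; rewrite mxE.
    case: (l =P m) => [lm | lm]; last first.
      by case: ifP => // /andP [/eqP ? /eqP ?]; case: lm; congruence.
    have -> : l = k by apply/val_inj/anti_leq; rewrite lk lm.
    have -> : m = k by apply/val_inj/anti_leq; rewrite km -lm lk.
    by rewrite eqxx.
  by rewrite !e // point_minors0.
- rewrite -f3; congr #|pred_of_set _|; apply/setP => k.
  apply/liveP/idP => [[i [j [ik kj]]]|]; rewrite inE.
    rewrite mxE; case: (i =P j) => [ij|]; last by rewrite eqxx.
    by have -> : i = k by apply/val_inj/anti_leq; rewrite ik ij.
  by exists k, k; rewrite mxE eqxx; split.
Qed.

Lemma block_family_sub : block_family F n 2 \subset flag_rank_sphere F n 3.
Proof.
apply/subsetP => _ /block_familyP [a [u [ad nz ->]]].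
apply/flag_rank_sphere3P; split; [exact: block_upper | exact: block_minors0 |].
by rewrite live_block // card_span_set.
Qed.

(** Corner [c] contains no entry of the block and every other corner misses the isolated entry, so
    the minors are handled separately. The block makes two corners live and [c] is the third. *)
Lemma block_point_family_sub :
  block_point_family F n 1 \subset flag_rank_sphere F n 3.
Proof.
apply/subsetP => _ /block_point_familyP [a [c [u [v [ad out nz vn ->]]]]].
apply/flag_rank_sphere3P; split.
- move=> i j ji; rewrite block_point_mxE block_upper // add0r ifF //.
  by apply/negP => /andP [/eqP ic /eqP jc]; move: ji; rewrite /= ic jc ltnn.
- move=> i i' k j j' ik i'k kj kj'; rewrite !block_point_mxE /=.
  have [kc|kc] := eqVneq k c.
    have b0 (l m : 'I_n) : (l <= k)%N -> (k <= m)%N -> block n a u l m = 0.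
      move=> lk km; apply: contraNeq out => /block_neq0; move: lk km.
      by rewrite kc; lia.
    by rewrite !b0 // !add0r; apply: point_minors0.
  have p0 (l m : 'I_n) :
      (l <= k)%N -> (k <= m)%N -> (l == c) && (m == c) = false.
    move=> lk km; apply: contraNF kc => /andP [/eqP lc /eqP mc].
    by apply/eqP/val_inj/anti_leq; rewrite -{1}mc km -lc lk.
  by rewrite !p0 // !addr0; apply: (@block_minors0 _ _ _ _ u _ _ k).
- have -> : live (@block_point_mx F n 1 (a, c, (u, v))) = c |: span_set n a 1.
    apply/setP => k; rewrite in_setU1 -(live_block ad nz).
    apply/liveP/orP => [[i [j [ik kj /block_point_mx_neq0]]] | []].
    + rewrite /= => /orP [|/andP [/eqP ic /eqP jc]].
        by move=> ?; right; rewrite live_block // inE; lia.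
      by left; apply/eqP/val_inj/anti_leq; rewrite -{1}jc kj -ic ik.
    + move/eqP->; exists c, c; split=> //; rewrite block_point_mxE /= eqxx /=.
      suff -> : block n a u c c = 0 by rewrite add0r.
      by apply: contraNeq out => /block_neq0; lia.
    + case/liveP => i [j [ik kj nzb]]; exists i, j; split=> //.
      rewrite block_point_mxE /= ifF ?addr0 //.
      apply: contraNF out => /andP [/eqP <- _].
      by move/block_neq0: nzb; lia.
  by rewrite cardsU1 card_span_set // inE out.
Qed.

Lemma interval_live M i j :
  M i j != 0 -> [set k : 'I_n | (i <= k <= j)%N] \subset live M.
Proof.
move=> nz; apply/subsetP => k; rewrite inE => /andP [ik kj].
by apply/liveP; exists i, j.
Qed.

(** An entry at distance 3 or more from the diagonal lies in at least four corners. *)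
Lemma sphere3_length M i j : M \in flag_rank_sphere F n 3 -> M i j != 0 ->
  (i <= j <= i + 2)%N.
Proof.
case/flag_rank_sphere3P => up _ lv nz.
have ij : (i <= j)%N by rewrite leqNgt; apply: contra nz => /up ->.
rewrite ij leqNgt /=; apply/negP => far.
have lt : (i + 3 < n)%N by apply: leq_ltn_trans (ltn_ord j); lia.
have : span_set n i 3 \subset live M.
  apply: subset_trans (interval_live nz); apply/subsetP => k; rewrite !inE; lia.
by move/subset_leq_card; rewrite lv card_span_set.
Qed.

(** The entry [M x y] already accounts for all three live corners. Any nonzero [M i j] makes corners
    [i] and [j] live, which confines it to the block. *)
Lemma sphere3_block M x y : M \in flag_rank_sphere F n 3 -> M x y != 0 ->
  y = (x + 2)%N :> nat -> M \in block_family F n 2.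
Proof.
move=> Ms nz yx; case/flag_rank_sphere3P: (Ms) => up minors lv.
have xn : (x + 2 < n)%N by rewrite -yx.
have lvE : span_set n x 2 = live M.
  apply/eqP; rewrite eqEcard lv card_span_set // leqnn andbT.
  by rewrite /span_set -yx; apply: interval_live.
have supp i j : M i j != 0 -> [&& x <= i, i <= j & j <= x + 2]%N.
  move=> nzij; have /andP [ij _] := sphere3_length Ms nzij.
  have /subsetP sub := interval_live nzij.
  have := sub i; have := sub j; rewrite -lvE !inE; lia.
have [|u uz Mu] := block_exists (erefl _) yx nz supp.
  by move=> i j xi ij jy; apply: (minors _ _ i) => //; apply: leq_trans jy.
by apply/block_familyP; exists x, u; rewrite uz.
Qed.

(** The entry [M x y] makes two corners live, leaving a single live corner [c]. The point is that no
    entry links [c] to the block when [c] is adjacent to it. *)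
Lemma sphere3_block_point M x y : M \in flag_rank_sphere F n 3 -> M x y != 0 ->
  y = (x + 1)%N :> nat ->
  (forall i j, j = (i + 2)%N :> nat -> M i j = 0) ->
  M \in block_point_family F n 1.
Proof.
move=> Ms nz yx no2; case/flag_rank_sphere3P: (Ms) => up minors lv.
have xn : (x + 1 < n)%N by rewrite -yx.
have sub : span_set n x 1 \subset live M.
  by rewrite /span_set -yx; apply: interval_live.
have /cards1P [c cE] : #|live M :\: span_set n x 1| == 1%N.
  by rewrite cardsD (setIidPr sub) lv card_span_set.
have lvE k : (k \in live M) = (k == c) || (x <= k <= x + 1)%N.
  by rewrite -(setID (live M) (span_set n x 1)) (setIidPr sub) cE !inE orbC.
have cout : ~~ (x <= c <= x + 1)%N.
  have : c \in live M :\: span_set n x 1 by rewrite cE inE.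
  by rewrite !inE => /andP [].
have supp i j : M i j != 0 ->
    [&& x <= i, i <= j & j <= x + 1]%N || (i == c) && (j == c).
  move=> nzij; have /andP [ij ij2] := sphere3_length Ms nzij.
  have ne2 : (j : nat) != (i + 2)%N by apply: contra nzij => /eqP/no2 ->.
  have /subsetP subij := interval_live nzij.
  have := subij i; have := subij j; rewrite !lvE !inE ij !leqnn -!val_eqE /=.
  move=> /(_ isT) jl /(_ isT) il.
  (* A link at [(x - 1, x)] would form with [M x y] a minor of corner [x] whose other product
     contains an entry at distance 2, zero by [no2]. *)
  have [ix|ix] := eqVneq (j : nat) x.
    have [ic|ic] := eqVneq (i.+1 : nat) x; last by lia.
    have : M i j * M x y == M i y * M x j.
      by apply/eqP; apply: (minors _ _ x) => //; lia.
    rewrite (no2 i y); last by lia.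
    by rewrite mul0r mulf_eq0 (negPf nz) (negPf nzij).
  (* Symmetrically, a link at [(y, y + 1)] is excluded by a minor of corner [y]. *)
  have [jy|jy] := eqVneq (i : nat) y; last by lia.
  have [jc|jc] := eqVneq (j : nat) y.+1; last by lia.
  have : M x y * M i j == M x j * M i y.
    by apply/eqP; apply: (minors _ _ y) => //; lia.
  rewrite (no2 x j); last by lia.
  by rewrite mul0r mulf_eq0 (negPf nz) (negPf nzij).
(* Clearing the entry at [(c, c)] leaves a matrix supported on the block, to which [block_exists]
   applies. *)
pose M' := \matrix_(i, j) if (i == c) && (j == c) then 0 else M i j.
have M'E i j : (x <= i)%N -> (j <= x + 1)%N -> (i <= j)%N -> M' i j = M i j.
  move=> xi jx ij; rewrite mxE ifF //.
  by apply: contraNF cout => /andP [/eqP <- _]; lia.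
have nz' : M' x y != 0 by rewrite M'E //; lia.
have supp' i j : M' i j != 0 -> [&& x <= i, i <= j & j <= x + 1]%N.
  rewrite mxE; case: ifP => [|ijc]; first by rewrite eqxx.
  by move/supp; rewrite ijc orbF.
have [|u uz M'u] := block_exists (erefl _) yx nz' supp'.
  move=> i j xi ij jy.
  rewrite !M'E //; try lia.
  by apply: (minors _ _ i) => //; lia.
(* Corner [c] is live but contains no position of the block, so its nonzero entry can only be at
   [(c, c)]. *)
have nzc : M c c != 0.
  have : c \in live M by rewrite lvE eqxx.
  case/liveP => i [j [ic cj nzij]].
  have /orP [|/andP [/eqP iE /eqP jE]] := supp _ _ nzij; last first.
    by rewrite iE jE in nzij.
  by move: cout; lia.
apply/block_point_familyP; exists x, c, u, (M c c); split=> //.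
  by rewrite uz.
apply/matrixP => i j; rewrite block_point_mxE /= -M'u mxE.
by case: ifP => [/andP [/eqP -> /eqP ->]|_]; rewrite ?add0r ?addr0.
Qed.

Lemma sphere3_diag M : M \in flag_rank_sphere F n 3 ->
  (forall i j, M i j != 0 -> i = j) -> M \in diag_family F n 3.
Proof.
move=> Ms dg; case/flag_rank_sphere3P: (Ms) => up minors lv.
apply/imsetP; exists [ffun i => M i i].
  rewrite inE -lv; apply/eqP; congr #|pred_of_set _|; apply/setP => k.
  rewrite inE ffunE; apply/idP/liveP => [nz | [i [j [ik kj nz]]]].
    by exists k, k.
  have e := dg _ _ nz; rewrite -e in nz kj.
  by have <- : i = k by apply/val_inj/anti_leq; rewrite ik.
apply/matrixP => i j; rewrite mxE ffunE; case: eqP => [<- //|ne].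
by apply: contra_not_eq ne => /dg.
Qed.

Lemma sphere3E : flag_rank_sphere F n 3 =
  diag_family F n 3 :|: block_point_family F n 1 :|: block_family F n 2.
Proof.
apply/eqP; rewrite eqEsubset !subUset diag_family_sub block_point_family_sub.
rewrite block_family_sub !andbT; apply/subsetP => M Ms; rewrite !inE.
have [/existsP [i /existsP [j /andP [/eqP ji nz]]]|no2] :=
  boolP [exists i : 'I_n, exists j : 'I_n,
           ((j : nat) == i + 2)%N && (M i j != 0)].
  by rewrite (sphere3_block Ms nz ji) !orbT.
have {}no2 i j : j = (i + 2)%N :> nat -> M i j = 0.
  move=> ji; apply: contraNeq no2 => nz.
  by apply/existsP; exists i; apply/existsP; exists j; rewrite ji eqxx.
have [/existsP [i /existsP [j /andP [/eqP ji nz]]]|no1] :=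
  boolP [exists i : 'I_n, exists j : 'I_n,
           ((j : nat) == i + 1)%N && (M i j != 0)].
  by rewrite (sphere3_block_point Ms nz ji no2) !orbT.
rewrite sphere3_diag // => i j nz; apply/val_inj => /=.
have /andP [ij ij2] := sphere3_length Ms nz.
have ne2 : (j : nat) != (i + 2)%N by apply: contra nz => /eqP/no2 ->.
suff ne1 : (j : nat) != (i + 1)%N by lia.
apply: contra no1 => ji; apply/existsP; exists i; apply/existsP; exists j.
by rewrite ji.
Qed.

(** The families are disjoint because the largest distance from the diagonal to a nonzero entry is
    0, 1 and 2 respectively. *)
Lemma card_sphere3 : #|flag_rank_sphere F n 3| =
  (#|diag_family F n 3| + #|block_point_family F n 1|
   + #|block_family F n 2|)%N.
Proof.
have diag0 M i j : M \in diag_family F n 3 -> (i < j)%N -> M i j = 0.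
  by case/imsetP => f _ -> ij; rewrite mxE -val_eqE /= ltn_eqF.
have point1 M : M \in block_point_family F n 1 ->
    exists i j : 'I_n, (i < j)%N /\ M i j != 0.
  case/block_point_familyP => a [c [u [v [ad out nz vn ->]]]].
  exists a, (Ordinal ad); split; first by rewrite /= addn1.
  rewrite block_point_mxE block_end //= ifF ?addr0 //.
  by apply: contraNF out => /andP [/eqP <- _]; lia.
have point0 M i j :
    M \in block_point_family F n 1 -> (i + 1 < j)%N -> M i j = 0.
  case/imsetP => x _ -> ij; apply/eqP; rewrite -[_ == 0]negbK.
  apply/negP => /block_point_mx_neq0/orP [|/andP [/eqP ic /eqP jc]].
    by lia.
  by move: ij; rewrite ic jc; lia.
have block2 M : M \in block_family F n 2 ->
    exists i j : 'I_n, (i + 1 < j)%N /\ M i j != 0.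
  case/block_familyP => a [u [ad nz ->]].
  by exists a, (Ordinal ad); rewrite block_end //= ltn_add2l.
rewrite sphere3E.
have disj2 : [disjoint diag_family F n 3 :|: block_point_family F n 1
              & block_family F n 2].
  rewrite -setI_eq0; apply/eqP/setP => M; rewrite !inE; apply/negP.
  case/andP => DP /block2 [i [j [ij /eqP []]]].
  by case/orP: DP => [/diag0|/point0]; apply; lia.
have disj1 : [disjoint diag_family F n 3 & block_point_family F n 1].
  rewrite -setI_eq0; apply/eqP/setP => M; rewrite !inE; apply/negP.
  by case/andP => /diag0 D /point1 [i [j [/D ->]]]; rewrite eqxx.
have [_] := leq_card_setU (diag_family F n 3 :|: block_point_family F n 1)
  (block_family F n 2); rewrite disj2 => /eqP ->.
have [_] := leq_card_setU (diag_family F n 3) (block_point_family F n 1).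
by rewrite disj1 => /eqP ->.
Qed.

End RadiusThree.
Theorem proposition3p3 (F : finFieldType) (q n : nat)
    (hq : #|F| = q) (hn : 3 <= n) :
  #|flag_rank_sphere F n 3| =
    (n - 2) * q ^ 4 * (q - 1) + (n - 1) * (n - 2) * q ^ 2 * (q - 1) ^ 2
    + 'C(n, 3) * (q - 1) ^ 3.
Proof.
rewrite card_sphere3 card_diag_family card_block_point_family //.
rewrite card_block_family hq.
(* The truncated differences become variables, in which the remaining identity is polynomial. *)
move: (q - 1) (n - 1) (n - 2) => r a b.
by rewrite !expnS expn0; ring.
Qed.
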